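(* Let $q$ be an odd prime power and $d\ge 2$ an integer. Let $P\subset\mathbb{F}_q^d\times\mathbb{F}_q^d$ and let $R$ be a set of rigid motions in $\mathbb{F}_q^d$. Then $$\left| I(P,R)-\frac{|P||R|}{q^d}\right|\ll q^{(d^2-d+2)/4}\sqrt{|P||R|}.$$
   Context: $\mathbb{F}_q$ is the finite field with $q$ elements. $O(d)$ is the group of $d\times d$ orthogonal matrices over $\mathbb{F}_q$ (those preserving $\|x\|=x_1^2+\cdots+x_d^2$). A rigid motion is a map $x\mapsto gx+z$ with $g\in O(d)$, $z\in\mathbb{F}_q^d$, identified with the pair $(g,z)$; so $R\subset O(d)\times\mathbb{F}_q^d$. The number of incidences is $I(P,R)=\#\{(x,y,g,z): (x,y)\in P,\ (g,z)\in R,\ x=gy+z\}$. $X\ll Y$ means $|X|\le CY$ for an absolute constant $C>0$; implicit constants may depend on $d$ only. *)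

(* Defs.v *)
From mathcomp Require Import all_boot all_algebra.

Set Implicit Arguments.
Unset Strict Implicit.
Unset Printing Implicit Defensive.

Import GRing.Theory.

Local Open Scope ring_scope.

(* Not a norm in the metric sense: nonzero vectors can have sqnorm 0. *)
Definition sqnorm (F : finFieldType) (d : nat) (x : 'cV[F]_d) : F :=
  \sum_(i < d) x i 0 ^+ 2.

Definition orthogonal_group (F : finFieldType) (d : nat) : {set 'M[F]_d} :=
  [set g | [forall x : 'cV[F]_d, sqnorm (g *m x) == sqnorm x]].

(* The pair (g, z) stands for the map x |-> g x + z. *)
Definition rigid_motions (F : finFieldType) (d : nat) :
    {set 'M[F]_d * 'cV[F]_d} :=
  setX (orthogonal_group F d) [set: 'cV[F]_d].

Definition incidences (F : finFieldType) (d : nat)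
    (P : {set 'cV[F]_d * 'cV[F]_d}) (M : {set 'M[F]_d * 'cV[F]_d}) : nat :=
  #|[set t : ('cV[F]_d * 'cV[F]_d) * ('M[F]_d * 'cV[F]_d) |
      let: ((x, y), (g, z)) := t in
      [&& (x, y) \in P, (g, z) \in M & x == g *m y + z]]|.

(* Main.v *)
Require Import Defs.
From mathcomp Require Import all_boot all_order all_algebra.
From mathcomp Require Import fingroup cyclic finalg mxabelem ring.
From mathcomp Require Import reals exp.

Set Implicit Arguments.
Unset Strict Implicit.
Unset Printing Implicit Defensive.

Import Order.TTheory GRing.Theory Num.Theory FinRing.Theory.

Local Open Scope ring_scope.

(** The bound is a second moment estimate. For a map [f] from a finite set [P] to
    a finite set [T], let the deviation of [f] be the sum over [t] of the squares
    of [#|f^-1(t)| - #|P| / #|T|]. A motion [(g, z)] has as many incidences as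
    [(x, y) |-> x - g y] has points of [P] over [z]. By Cauchy-Schwarz the square
    of the error term is therefore at most [#|M|] times the sum over the
    orthogonal matrices [g] of the deviation of [(x, y) |-> x - g y].

    To bound that sum, deviations are averaged over hyperplanes: for [f] with
    values in [F^n], the deviations of [p |-> b . f p], summed over the row
    vectors [b != 0], give [(q^n - q^(n-1))] times the deviation of [f]
    ([deviation_hyperplanes]). This is Plancherel's identity with the characters
    grouped along the lines of the dual space; since the weights below are
    constant along these lines, no character is needed. Since
    [b . (x - g y) = b . x - (b g) . y], the functional obtained from [b] and [g]
    on [F^d x F^d] is the row [(b, - b g)], and a given row with first half
    [b != 0] arises from as many [g] as there are orthogonal [g] with prescribed
    [b g], say at most [K]. Averaging back over all nonzero functionals on [F^(2d)]
    bounds the sum of deviations by [K q^d] times the deviation of the identity of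
    [P], which is at most [#|P|] ([sum_deviation_orthogonal]).

    It remains to see that [K] has order [q^((d-1)(d-2)/2)]
    ([card_orthogonal_agree]). Extend [b] to a basis and choose the images of the
    basis vectors one at a time: when the image of an [m]-dimensional subspace is
    known, the image of the next vector lies in an affine subspace of dimension
    [d - m], because its products with the known images are prescribed, and on a
    quadric that does not contain this affine subspace, because its norm is
    prescribed and it lies outside the span of the known images. This leaves at
    most [2 q^(d-m-1)] choices ([card_quadric_section]). *)

(** * Orthogonal matrices with a prescribed restriction to a subspace *)

Section OrthogonalGroup.
Variables (F : finFieldType).

Lemma card_left_kernel n m (A : 'M[F]_(n, m)) :
  #|[set v : 'rV_n | v *m A == 0%R]| = (#|F| ^ (n - \rank A))%N.
Proof.
rewrite -mxrank_ker -card_rowg.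
by apply: eq_card => v; rewrite inE in_set /= -sub_kermx.
Qed.

(** In characteristic 2, every odd multiple of [1] is [1], but [#|F|] times [1]
    is [0] by Lagrange's theorem in the additive group of [F]. *)
Lemma two_neq0 : odd #|F| -> (2%:R : F) != 0.
Proof.
move=> oddF; apply/eqP => two0.
have /eqP := expg_cardG (in_setT (1 : F)).
rewrite zmodXgE cardsT -(odd_double_half #|F|) oddF -mul2n natrD natrM two0.
by rewrite mul0r addr0 oner_eq0.
Qed.

Lemma card_quadratic_roots (a b c : F) :
  (a != 0) || (b != 0) ->
  (#|[set t : F | (a * t ^+ 2 + b * t + c == 0)%R]| <= 2)%N.
Proof.
move=> ab_neq0; pose p := Poly [:: c; b; a].
have p_neq0 : p != 0.
  apply: contraTneq ab_neq0 => p0.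
  have := coef_Poly [:: c; b; a] 2; have := coef_Poly [:: c; b; a] 1.
  by rewrite -/p p0 !coef0 /= => <- <-; rewrite eqxx.
have size_p : (size p <= 3)%N by apply: size_Poly.
rewrite -ltnS; apply: leq_trans size_p; rewrite cardE.
apply: max_poly_roots (enum_uniq _) => //.
apply/allP => t; rewrite mem_enum inE => /eqP root_t.
by rewrite /root /p horner_Poly /= mul0r add0r -root_t; apply/eqP; ring.
Qed.

Definition dot n (v w : 'rV[F]_n) : F := (v *m w^T) 0 0.

Lemma dotC n (v w : 'rV[F]_n) : dot v w = dot w v.
Proof. by rewrite /dot -[v in LHS]trmxK -trmx_mul mxE. Qed.

Lemma dotDl n (u v w : 'rV[F]_n) : dot (u + v) w = dot u w + dot v w.
Proof. by rewrite /dot mulmxDl mxE. Qed.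

Lemma dotZl n a (v w : 'rV[F]_n) : dot (a *: v) w = a * dot v w.
Proof. by rewrite /dot -scalemxAl mxE. Qed.

Lemma dotDr n (u v w : 'rV[F]_n) : dot u (v + w) = dot u v + dot u w.
Proof. by rewrite !(dotC u) dotDl. Qed.

Lemma dotZr n a (v w : 'rV[F]_n) : dot v (a *: w) = a * dot v w.
Proof. by rewrite !(dotC v) dotZl. Qed.

(** A subspace is the orthogonal of its orthogonal: the columns of [cokermx A]
    span the orthogonal of the row space of [A], and [v] lies in that row space
    exactly when it is orthogonal to all of them. *)
Lemma not_submx_dot_witness m n (A : 'M[F]_(m, n)) (v : 'rV_n) :
  ~~ (v <= A)%MS -> exists2 u : 'rV_n, u *m A^T = 0 & dot v u != 0.
Proof.
rewrite submxE => /eqP/matrixP nz.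
have /existsP[j nzj] : [exists j, (v *m cokermx A) 0 j != 0].
  apply/contraT; rewrite negb_exists => /forallP z; case: nz => i j.
  by rewrite ord1 [RHS]mxE; apply/eqP; have := z j; rewrite negbK.
exists (col j (cokermx A))^T.
  by rewrite -trmx_mul colE mulmxA mulmx_coker mul0mx trmx0.
by rewrite /dot trmxK colE mulmxA -colE mxE.
Qed.

(** The solutions [v] lie in the coset [v1 + K] of the orthogonal [K] of the row
    space of [A], and it suffices to find a direction [v0] in [K] along which
    every line of [v1 + K] contains at most two of them. On the line through
    [v1 + u], the condition on the norm is quadratic in the parameter, with
    coefficients [dot v0 v0] and [2 * dot (v1 + u) v0]. Any anisotropic [v0] makes
    the first one nonzero. If [K] has no such vector, the form vanishes on
    [K], so the second one is [2 * dot v1 v0] whatever [u], and [v1] not being in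
    the row space provides [v0] with [dot v1 v0 != 0]. *)
Lemma card_quadric_section m n (A : 'M[F]_(m, n)) (v1 : 'rV_n) :
  odd #|F| -> ~~ (v1 <= A)%MS ->
  (#|[set v : 'rV_n | (v *m A^T == v1 *m A^T) && (dot v v == dot v1 v1)]|
     * #|F| <= 2 * #|F| ^ (n - \rank A))%N.
Proof.
move=> oddF v1A; set Z := [set v | _].
have two0 := two_neq0 oddF.
pose K := [set u : 'rV[F]_n | u *m A^T == 0].
have cardK : #|K| = (#|F| ^ (n - \rank A))%N by rewrite card_left_kernel mxrank_tr.
have [v0 v0K v0P] : exists2 v0 : 'rV[F]_n, v0 \in K &
   (dot v0 v0 != 0) \/ (forall u, u \in K -> dot (v1 + u) v0 != 0).
  have [/existsP[v0 /andP[? ?]]|] := boolP [exists v in K, dot v v != 0].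
    by exists v0 => //; left.
  (* All of K is isotropic, hence, as 2 is invertible, totally isotropic. *)
  rewrite negb_exists => /forallP isoK.
  have {}isoK u : u \in K -> dot u u = 0.
    by move=> uK; have := isoK u; rewrite uK negbK => /eqP.
  have [u uA v1u] := not_submx_dot_witness v1A.
  have uK : u \in K by rewrite inE uA.
  exists u => //; right => w wK; rewrite dotDl.
  have : dot (w + u) (w + u) = 0.
    by apply: isoK; move: wK uK; rewrite !inE mulmxDl => /eqP-> /eqP->; rewrite addr0.
  rewrite !(dotDl, dotDr) !isoK // add0r addr0 (dotC u) -mulr2n -mulr_natl.
  by move/eqP; rewrite mulf_eq0 (negPf two0) => /eqP ->; rewrite addr0.
have v0A : v0 *m A^T = 0 by apply/eqP; rewrite inE in v0K.
rewrite -cardK -[X in (_ <= X)%N]mulnC -[X in (_ <= X)%N]sum_nat_const.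
pose line u := [set t : F | v1 + u + t *: v0 \in Z].
(* For each parameter t, the points v1 + u + t *: v0 run through the coset. *)
have -> : (#|Z| * #|F| = \sum_(u in K) #|line u|)%N.
  under eq_bigr do rewrite -sum1dep_card big_mkcond /=.
  rewrite exchange_big /= mulnC -sum_nat_const; apply: eq_bigr => t _.
  rewrite -big_mkcondr /= -sum1_card.
  rewrite (reindex_inj (h := fun u => v1 + u + t *: v0)) /=; last first.
    by move=> u u' /addIr /addrI.
  apply: eq_bigl => u; rewrite !inE !mulmxDl -scalemxAl v0A scaler0 addr0.
  by rewrite -[X in _ == X]addr0 (inj_eq (addrI _)) andbA andbb.
apply: leq_sum => u uK.
have uA : u *m A^T = 0 by apply/eqP; rewrite inE in uK.
have -> : line u = [set t | dot v0 v0 * t ^+ 2 + (2%:R * dot (v1 + u) v0) * t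
   + (dot (v1 + u) (v1 + u) - dot v1 v1) == 0].
  apply/setP=> t; rewrite !inE !mulmxDl -scalemxAl v0A uA scaler0 !addr0 eqxx /=.
  rewrite -subr_eq0; congr (_ == _).
  rewrite [LHS]/= !(dotDl _ _ (_ + _)) !(dotDr _ _ (t *: v0)).
  rewrite !(dotDl, dotDr, dotZl, dotZr) (dotC v0) (dotC v0 u) (dotC u v1).
  by ring.
apply: card_quadratic_roots; case: v0P => [->//|/(_ u uK) nz].
by rewrite mulf_neq0 ?orbT.
Qed.

Lemma sqnormE n (x : 'cV[F]_n) : sqnorm x = dot x^T x^T.
Proof.
by rewrite /dot mxE; apply: eq_bigr => i _; rewrite !mxE expr2.
Qed.

(** Polarization: as 2 is invertible, preserving the quadratic form amounts to
    preserving the dot product. *)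
Lemma orthogonal_mulmx_tr n (g : 'M[F]_n) :
  odd #|F| -> g \in orthogonal_group F n -> g *m g^T = 1%:M.
Proof.
move=> oddF; rewrite inE => /forallP gO; apply: mulmx1C.
have preserve (v w : 'rV_n) : dot (v *m g^T) (w *m g^T) = dot v w.
  have norm u : dot (u *m g^T) (u *m g^T) = dot u u.
    have /eqP := gO u^T.
    by rewrite !sqnormE trmx_mul trmxK.
  have := norm (v + w); rewrite mulmxDl !(dotDl, dotDr) !norm.
  rewrite -!addrA => /addrI; rewrite !addrA => /addIr.
  rewrite (dotC (w *m _)) (dotC w) => e.
  by apply: (mulfI (two_neq0 oddF)); rewrite !mulr_natl !mulr2n.
apply/matrixP => i j.
have := preserve (delta_mx 0 i) (delta_mx 0 j).
rewrite /dot trmx_mul trmxK -!mulmxA [g^T *m _]mulmxA trmx_delta.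
by rewrite -rowE -colE [LHS]mxE [LHS]mxE => ->;
  rewrite -rowE !mxE eqxx andbT eq_sym.
Qed.

Lemma dot_orthogonal n (g : 'M[F]_n) (v w : 'rV_n) :
  g *m g^T = 1%:M -> dot (v *m g) (w *m g) = dot v w.
Proof.
by move=> gO; rewrite /dot trmx_mul mulmxA -(mulmxA v) gO mulmx1.
Qed.

(** With [q = #|F|], the bound is the product of the numbers [2 q^i] of choices,
    [i < r], for the images of the vectors completing a basis of the row space of
    [A]. The induction adjoins a vector [w] to [A] and sorts the matrices by the
    image of [w]. *)
Lemma card_orthogonal_agree n r m (A : 'M[F]_(m, n)) (g0 : 'M[F]_n) :
  odd #|F| -> (n - \rank A)%N = r ->
  (#|[set g in orthogonal_group F n | A *m g == A *m g0]|
     <= 2 ^ r * #|F| ^ 'C(r, 2))%N.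
Proof.
move=> oddF; elim: r m A g0 => [|r IHr] m A g0 rankA.
  have /row_fullP[B BA] : row_full A.
    by rewrite /row_full eqn_leq rank_leq_col -subn_eq0 rankA.
  rewrite mul1n expn0; apply/card_le1_eqP => g h.
  rewrite !inE => /andP[_ /eqP gA] /andP[_ /eqP hA].
  by rewrite -[g]mul1mx -[h]mul1mx -BA -!mulmxA gA hA.
have [w wA] : exists w : 'rV_n, ~~ (w <= A)%MS.
  have : ~~ (1%:M <= A)%MS.
    by rewrite sub1mx /row_full neq_ltn -subn_gt0 rankA.
  by move/row_subPn => [i niA]; exists (row i 1%:M).
have rankAw : \rank (col_mx A w) = (\rank A).+1.
  rewrite -addsmxE mxrank_disjoint_sum; last first.
    apply/eqP/rowV0Pn => -[v]; rewrite sub_capmx.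
    case/andP => vA /sub_rVP[a va] v0; case/negP: wA.
    have a0 : a != 0 by apply: contraNneq v0 => a0; rewrite va a0 scale0r.
    by rewrite -(eqmx_scale w a0) -va.
  rewrite rank_rV; have -> : w != 0; last by rewrite addn1.
  by apply: contraNneq wA => ->; rewrite sub0mx.
set X := [set g in _ | _].
have [->|[g1 g1X]] := set_0Vmem X; first by rewrite cards0.
have XP g : g \in X -> g *m g^T = 1%:M /\ A *m g = A *m g0.
  by rewrite inE => /andP[/(orthogonal_mulmx_tr oddF)-> /eqP->].
have [g1O g1A] := XP _ g1X.
have free_g1 : row_free g1 by apply/row_freeP; exists g1^T.
rewrite -sum1_card.
rewrite (partition_big (fun g => w *m g) [in [set w *m g | g in X]]) /=; last first.
  by move=> g gX; apply: imset_f.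
(* The image of w is confined to a quadric section as soon as one g1 exists. *)
have images : (#|[set w *m g | g in X]| <= 2 * #|F| ^ r)%N.
  have q_gt0 : (0 < #|F|)%N by apply/card_gt0P; exists 0.
  have wAg1 : ~~ (w *m g1 <= A *m g1)%MS by rewrite submxMfree.
  rewrite -(leq_pmul2r q_gt0) -mulnA -expnSr -rankA -(mxrankMfree A free_g1).
  apply: leq_trans (card_quadric_section oddF wAg1).
  rewrite leq_mul2r subset_leq_card ?orbT //.
  apply/subsetP => _ /imsetP[g /XP[gO gA] ->]; rewrite inE.
  rewrite !dot_orthogonal // eqxx andbT {1}g1A -gA !trmx_mul !mulmxA.
  by rewrite -(mulmxA w g) gO -(mulmxA w g1) g1O.
apply: leq_trans (_ : \sum_(v in [set w *m g | g in X]) 2 ^ r * #|F| ^ 'C(r, 2) <= _)%N.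
  apply: leq_sum => _ /imsetP[g2 g2X ->].
  have rankAw' : (n - \rank (col_mx A w))%N = r by rewrite rankAw subnS rankA.
  apply: leq_trans (IHr _ _ g2 rankAw'); rewrite sum1dep_card subset_leq_card //.
  apply/subsetP => g; rewrite inE => /andP[gX /eqP wg].
  have [_ gA] := XP _ gX; have [_ g2A] := XP _ g2X.
  move: gX; rewrite !inE => /andP[-> _] /=.
  by rewrite !mul_col_mx gA g2A wg.
rewrite sum_nat_const; apply: leq_trans (leq_mul images (leqnn _)) _.
by rewrite binS bin1 addnC expnD expnS mulnACA.
Qed.

End OrthogonalGroup.

(** * Deviation from equidistribution *)

Lemma sum_indicator (R : pzSemiRingType) (T : finType) (A : pred T) :
  \sum_x (A x)%:R = #|[set x | A x]|%:R :> R.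
Proof.
by rewrite -sum1dep_card natr_sum [RHS]big_mkcond; apply: eq_bigr => x _; case: (A x).
Qed.

(** Cauchy-Schwarz against the constant 1, from the nonnegativity of
    the sum of the [(#|A| x_i - S)^2], where [S] is the sum of the [x_i]. *)
Lemma sqr_sum_le (R : realFieldType) (I : finType) (A : {set I}) (x : I -> R) :
  (\sum_(i in A) x i) ^+ 2 <= #|A|%:R * \sum_(i in A) x i ^+ 2.
Proof.
have [->|[i0 i0A]] := set_0Vmem A; first by rewrite !big_set0 cards0 expr0n mul0r.
have A_gt0 : 0 < #|A|%:R :> R by rewrite ltr0n; apply/card_gt0P; exists i0.
set S := \sum_(i in A) x i.
have : 0 <= \sum_(i in A) (#|A|%:R * x i - S) ^+ 2.
  by apply: sumr_ge0 => i _; apply: sqr_ge0.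
have -> : \sum_(i in A) (#|A|%:R * x i - S) ^+ 2
    = #|A|%:R * (#|A|%:R * (\sum_(i in A) x i ^+ 2) - S ^+ 2).
  under eq_bigr do rewrite sqrrB exprMn.
  rewrite !big_split /= sumrN sumrMnl -mulr_suml -!mulr_sumr sumr_const -/S.
  by rewrite -[_ *+ #|A|]mulr_natl; ring.
by rewrite pmulr_rge0 // subr_ge0.
Qed.

Section Deviation.
Variables (R : realFieldType) (I T : finType) (P : {set I}).

Definition deviation (f : I -> T) : R :=
  \sum_(t : T) (#|[set p in P | f p == t]|%:R - #|P|%:R / #|T|%:R) ^+ 2.

(** The second moment of the fiber cardinals; as a sum over pairs of points it can
    be averaged over linear functionals one pair at a time. *)
Definition collisions (f : I -> T) : R :=
  \sum_(p in P) \sum_(p' in P) (f p == f p')%:R.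

Lemma deviation_ge0 f : 0 <= deviation f.
Proof. by apply: sumr_ge0 => t _; apply: sqr_ge0. Qed.

Lemma collisionsE f : collisions f = \sum_t #|[set p in P | f p == t]|%:R ^+ 2.
Proof.
rewrite /collisions (partition_big f predT) //=; apply: eq_bigr => t _.
have cardE : \sum_(p' in P) (t == f p')%:R = #|[set p' in P | f p' == t]|%:R :> R.
  rewrite -sum1dep_card natr_sum big_mkcondr /=; apply: eq_bigr => p' _.
  by rewrite eq_sym; case: eqP.
under eq_bigr => p /andP[_ /eqP->] do rewrite cardE.
rewrite sumr_const expr2 mulr_natr; congr (_ *+ _).
by apply: eq_card => p; rewrite !inE.
Qed.

Lemma sum_card_fibers (f : I -> T) :
  \sum_t #|[set p in P | f p == t]|%:R = #|P|%:R :> R.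
Proof.
rewrite -natr_sum -sum1_card (partition_big f predT) //=.
by congr _%:R; apply: eq_bigr => t _; rewrite sum1dep_card.
Qed.

Lemma deviationE f :
  (0 < #|T|)%N -> deviation f = collisions f - #|P|%:R ^+ 2 / #|T|%:R.
Proof.
move=> T0; have T0' : #|T|%:R != 0 :> R by rewrite pnatr_eq0 -lt0n.
rewrite collisionsE /deviation.
under eq_bigr do rewrite sqrrB.
rewrite !big_split /= sumrN sumrMnl -mulr_suml sum_card_fibers sumr_const.
by rewrite -mulr_natl; field.
Qed.

Lemma deviation_inj_le f :
  (0 < #|T|)%N -> injective f -> deviation f <= #|P|%:R.
Proof.
move=> T0 f_inj; rewrite deviationE // (_ : collisions _ = #|P|%:R).
  by rewrite gerBl divr_ge0 ?exprn_ge0.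
rewrite /collisions -sum1_card natr_sum; apply: eq_bigr => p pP.
rewrite (bigD1 p) //= eqxx big1 ?addr0 // => p' /andP[_ /negPf p'p].
by rewrite (inj_eq f_inj) eq_sym p'p.
Qed.

End Deviation.

(** * Averaging over hyperplanes *)

Section Hyperplanes.
Variables (R : realFieldType) (F : finFieldType).
Local Notation q := (#|F|%:R : R).

Lemma natr_card_field_neq0 : q != 0.
Proof. by rewrite pnatr_eq0 -lt0n; apply/card_gt0P; exists 0. Qed.

(** [q ^+ n / q] stands for [q^(n-1)], so that the formula also holds for
    [n = 0], where [u = 0]. *)
Lemma sum_hyperplanes_through n (u : 'cV[F]_n) :
  \sum_(b : 'rV_n) (b *m u == 0)%:R = q ^+ n / q + (q ^+ n - q ^+ n / q) * (u == 0)%:R.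
Proof.
have q0 := natr_card_field_neq0.
rewrite sum_indicator card_left_kernel -mxrank_tr rank_rV trmx_eq0 natrX.
case: eqVneq => [_|u0] /=; first by rewrite subn0 mulr1 addrC subrK.
have n0 : (0 < n)%N by case: (n) u u0 => // u; rewrite (flatmx0 u) eqxx.
by rewrite mulr0 addr0 -{2}(subnK n0) addn1 exprSr mulfK.
Qed.

(** A pair of points with distinct images under [f] collides under
    [p |-> b . f p] for [q^(n-1)] of the functionals [b], any other pair for all
    [q^n] of them. So summing over all [b] turns [collisions] of the composites
    into [q^n - q^(n-1)] times [collisions] of [f], plus [q^(n-1) #|P|^2], which is
    the sum of the terms [#|P|^2 / q] subtracted in the [q^n] deviations. The
    functional [b = 0] contributes [#|P|^2 - #|P|^2 / q], that is
    [(q^n - q^(n-1)) #|P|^2 / q^n]: its removal turns [collisions] of [f] into the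
    deviation of [f]. *)
Lemma deviation_hyperplanes n (I : finType) (P : {set I}) (f : I -> 'cV[F]_n) :
  \sum_(b : 'rV_n | b != 0) deviation R P (fun p => b *m f p)
    = (q ^+ n - q ^+ n / q) * deviation R P f.
Proof.
have q0 := natr_card_field_neq0.
have card_gt0 m k : (0 < #|'M[F]_(m, k)|)%N by apply/card_gt0P; exists 0.
rewrite deviationE //.
have dE (b : 'rV_n) : deviation R P (fun p => b *m f p)
    = collisions R P (fun p => b *m f p) - #|P|%:R ^+ 2 / q.
  by rewrite deviationE // card_mx.
under eq_bigr do rewrite dE.
have : \sum_(b : 'rV_n) (collisions R P (fun p => b *m f p) - #|P|%:R ^+ 2 / q)
  = (q ^+ n - q ^+ n / q) * collisions R P f.
  rewrite big_split /= /collisions exchange_big /=.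
  under eq_bigr => p _.
    rewrite exchange_big /=.
    under eq_bigr => p' _.
      under eq_bigr do rewrite -subr_eq0 -mulmxBr.
      rewrite sum_hyperplanes_through subr_eq0.
      over.
    rewrite big_split /= sumr_const -mulr_sumr.
    over.
  rewrite big_split /= !sumr_const -mulr_sumr card_mx mul1n.
  by rewrite -(mulr_natr (_ / _ *+ _)) -(mulr_natr (_ / _)) -(mulr_natr (- _)) natrX; field.
rewrite (bigD1 0) //= => /(canRL (addKr _)) ->.
have -> : collisions R P (fun p => (0 : 'rV_n) *m f p) = #|P|%:R ^+ 2.
  rewrite /collisions.
  under eq_bigr => p _.
    under eq_bigr => p' _ do rewrite !mul0mx eqxx.
    rewrite sumr_const.
    over.
  by rewrite sumr_const -mulrnA natrM expr2.
by rewrite card_mx muln1 natrX; field; rewrite expf_neq0.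
Qed.

End Hyperplanes.

(** * Incidences with rigid motions *)

Section Incidences.
Variables (R : realFieldType) (F : finFieldType) (d : nat).
Variable P : {set 'cV[F]_d * 'cV[F]_d}.
Local Notation q := (#|F|%:R : R).

(** [K] bounds the number of orthogonal [g] that turn a given [b != 0] into a given
    functional [(b, - b g)]; replacing this multiplicity by [K] and then letting
    all nonzero functionals in loses nothing of the order of magnitude. The factor
    [c = q^d - q^(d-1)] of the averaging over [F^d] divides the factor
    [q^(2d) - q^(2d-1) = q^d c] of the averaging over [F^(2d)]. *)
Lemma sum_deviation_orthogonal :
  odd #|F| -> (0 < d)%N ->
  \sum_(g in orthogonal_group F d) deviation R P (fun p => p.1 - g *m p.2)
    <= (2 ^ d.-1 * #|F| ^ 'C(d.-1, 2))%N%:R * q ^+ d * #|P|%:R.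
Proof.
move=> oddF d_gt0; set K := (_ * _)%N; set O := orthogonal_group F d.
have q_gt1 : 1 < q by rewrite ltr1n card_finNzRing_gt1.
have q_gt0 : 0 < q by apply: lt_trans q_gt1.
pose c := q ^+ d - q ^+ d / q.
have c_gt0 : 0 < c.
  by rewrite subr_gt0 ltr_pdivrMr // ltr_pMr // exprn_gt0.
pose E (b : 'rV[F]_(d + d)) := deviation R P (fun p => b *m col_mx p.1 p.2).
have E_ge0 b : 0 <= E b by apply: deviation_ge0.
have fiber_le (b a : 'rV[F]_d) : b != 0 ->
    (#|[set g in O | - (b *m g) == a]| <= K)%N.
  move=> b0; have [->|[g0]] := set_0Vmem [set g in O | - (b *m g) == a].
    by rewrite cards0.
  rewrite inE => /andP[_ /eqP g0a].
  have rank_b : (d - \rank b)%N = d.-1 by rewrite rank_rV b0 subn1.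
  apply: leq_trans (card_orthogonal_agree g0 oddF rank_b).
  apply: subset_leq_card; apply/subsetP => g; rewrite !inE.
  by rewrite -g0a eqr_opp.
rewrite -(ler_pM2l c_gt0) mulr_sumr.
under eq_bigr do rewrite -deviation_hyperplanes.
rewrite exchange_big /=.
have -> : \sum_(b : 'rV[F]_d | b != 0) \sum_(g in O)
      deviation R P (fun p => b *m (p.1 - g *m p.2))
    = \sum_(b : 'rV[F]_d | b != 0) \sum_(a : 'rV[F]_d)
      #|[set g in O | - (b *m g) == a]|%:R * E (row_mx b a).
  apply: eq_bigr => b _.
  rewrite (partition_big (fun g => - (b *m g)) predT) //=.
  apply: eq_bigr => a _; rewrite mulr_natl -sumr_const.
  apply: eq_big => [g|g /andP[_ /eqP<-]]; first by rewrite inE.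
  apply: eq_bigr => t _.
  congr ((_%:R - _) ^+ 2); apply: eq_card => p; rewrite !inE; congr (_ && (_ == _)).
  by rewrite mul_row_col mulNmx mulmxBr mulmxA.
apply: (@le_trans _ _ (K%:R * \sum_(b : 'rV[F]_(d + d) | b != 0) E b)).
  rewrite pair_big_dep /= mulr_sumr.
  rewrite [leRHS](reindex (fun p : 'rV_d * 'rV_d => row_mx p.1 p.2)) /=; last first.
    exists (fun b => (lsubmx b, rsubmx b)) => [[b a]|b] _ /=.
      by rewrite row_mxKl row_mxKr.
    by rewrite hsubmxK.
  rewrite big_mkcond [leRHS]big_mkcond /=; apply: ler_sum => -[b a] _ /=.
  rewrite andbT row_mx_eq0; case: eqVneq => [_|b0] /=.
    by case: ifP => // _; rewrite mulr_ge0.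
  by rewrite ler_wpM2r // ler_nat fiber_le.
rewrite deviation_hyperplanes exprD.
have -> : q ^+ d * q ^+ d - q ^+ d * q ^+ d / q = q ^+ d * c.
  by rewrite mulrBr mulrA.
have -> : c * (K%:R * q ^+ d * #|P|%:R) = K%:R * (q ^+ d * c * #|P|%:R) by ring.
rewrite ler_wpM2l // ler_wpM2l //; first by rewrite mulr_ge0 ?exprn_ge0 ?ltW.
apply: deviation_inj_le; first by apply/card_gt0P; exists 0.
by move=> [x y] [x' y'] /= /eq_col_mx[-> ->].
Qed.

Lemma incidences_sum_fibers (M : {set 'M[F]_d * 'cV[F]_d}) :
  incidences P M
    = (\sum_(m in M) #|[set p in P | (p.1 - m.1 *m p.2 == m.2)%R]|)%N.
Proof.
rewrite /incidences -sum1_card (partition_big snd [in M]) /=; last first.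
  by case=> [[x y] [g z]]; rewrite inE => /and3P[].
apply: eq_bigr => -[g z] gzM.
rewrite sum1dep_card -[RHS](card_imset _ (f := fun p => (p, (g, z)))); last first.
  by move=> p p' [].
apply: eq_card => -[[x y] [h w]]; rewrite !inE.
apply/andP/imsetP => [[/and3P[xyP _ /eqP xy] /eqP[<- <-]]|[[x' y']]].
  by exists (x, y) => //; rewrite !inE xyP xy /= addrC addKr.
rewrite !inE /= => /andP[xyP /eqP xy] [-> -> -> ->].
by rewrite xyP gzM eqxx -xy addrC subrK eqxx.
Qed.

Lemma sqr_incidences_error (M : {set 'M[F]_d * 'cV[F]_d}) :
  odd #|F| -> (0 < d)%N -> M \subset rigid_motions F d ->
  ((incidences P M)%:R - (#|P|%:R * #|M|%:R) / q ^+ d) ^+ 2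
    <= (2 ^ d.-1)%:R * q ^+ (d + 'C(d.-1, 2)) * (#|P|%:R * #|M|%:R).
Proof.
move=> oddF d_gt0 MO.
pose err (m : 'M[F]_d * 'cV[F]_d) : R :=
  #|[set p in P | p.1 - m.1 *m p.2 == m.2]|%:R - #|P|%:R / q ^+ d.
have -> : (incidences P M)%:R - (#|P|%:R * #|M|%:R) / q ^+ d = \sum_(m in M) err m.
  rewrite sumrB sumr_const incidences_sum_fibers natr_sum; congr (_ - _).
  by rewrite -[RHS]mulr_natr mulrAC.
apply: le_trans (sqr_sum_le _ _) _.
have -> : (2 ^ d.-1)%:R * q ^+ (d + 'C(d.-1, 2)) * (#|P|%:R * #|M|%:R)
  = #|M|%:R * ((2 ^ d.-1 * #|F| ^ 'C(d.-1, 2))%N%:R * q ^+ d * #|P|%:R).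
  by rewrite exprD natrM !natrX; ring.
rewrite ler_wpM2l //; apply: le_trans (sum_deviation_orthogonal oddF d_gt0).
have -> : \sum_(g in orthogonal_group F d) deviation R P (fun p => p.1 - g *m p.2)
    = \sum_(m in rigid_motions F d) err m ^+ 2.
  rewrite (eq_bigl (fun m : _ * _ => (m.1 \in orthogonal_group F d) && true)); last first.
    by case=> g z; rewrite in_setX in_setT.
  rewrite -(pair_big (mem (orthogonal_group F d)) xpredT (fun g z => err (g, z) ^+ 2)) /=.
  by apply: eq_bigr => g _; apply: eq_bigr => z _; rewrite card_mx muln1 natrX.
rewrite [leRHS](big_setID M) (setIidPr MO) /= lerDl.
by apply: sumr_ge0 => m _; apply: sqr_ge0.
Qed.

End Incidences.

(** Twice the exponent of the theorem is [d + (d-1)(d-2)/2], the power of [q] that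
    bounds the square of the error. *)
Lemma exponent_doubled (R : numFieldType) d : (0 < d)%N ->
  (d%:R ^+ 2 - d%:R + 2%:R) / 4%:R * 2%:R = (d + 'C(d.-1, 2))%:R :> R.
Proof.
case: d => // d _ /=.
have binE : 'C(d, 2)%:R * 2%:R = d%:R * (d%:R - 1) :> R.
  case: d => [|d]; first by rewrite bin_small // !mul0r.
  rewrite bin2 -natrM muln2 (_ : (d.+1 * d.+1.-1)./2.*2 = d.+1 * d)%N.
    by rewrite natrM -natr1 addrK.
  by rewrite -[RHS]odd_double_half oddM /= andNb.
rewrite natrD; apply: (mulIf (_ : 2%:R != 0)); first by rewrite pnatr_eq0.
by rewrite [RHS]mulrDl binE -natr1; field.
Qed.

Theorem theorem3p1 (R : realType) (d : nat) (d_ge2 : (2 <= d)%N) :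
  exists C : R, 0 < C /\
    forall (F : finFieldType) (q_odd : odd #|F|)
           (P : {set 'cV[F]_d * 'cV[F]_d})
           (M : {set 'M[F]_d * 'cV[F]_d})
           (M_rigid : M \subset rigid_motions F d),
      `| (incidences P M)%:R - (#|P|%:R * #|M|%:R) / #|F|%:R ^+ d |
        <= C * (#|F|%:R `^ ((d%:R ^+ 2 - d%:R + 2%:R) / 4%:R)
                * Num.sqrt (#|P|%:R * #|M|%:R)).
Proof.
have d_gt0 : (0 < d)%N by apply: leq_trans d_ge2.
exists (Num.sqrt (2 ^ d.-1)%:R); split.
  by rewrite sqrtr_gt0 ltr0n expn_gt0.
move=> F q_odd P M M_rigid; set e := (_ / 4%:R).
rewrite -sqrtr_sqr.
have -> : #|F|%:R `^ e = Num.sqrt (#|F|%:R ^+ (d + 'C(d.-1, 2))).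
  rewrite -powR_mulrn // -exponent_doubled // -/e [in RHS]powRrM powR_mulrn ?powR_ge0 //.
  by rewrite sqrtr_sqr ger0_norm ?powR_ge0.
rewrite mulrA -!sqrtrM ?mulr_ge0 ?exprn_ge0 //.
by rewrite ler_sqrt ?mulr_ge0 ?exprn_ge0 //; apply: sqr_incidences_error.
Qed.
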